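(* Let $G$ be a finitely generated group, and let $Y$ be a subgraph of the Cayley graph $\mathcal{C}(G)$ that satisfies the deep, shallow, 3-separating and noncrossing conditions. Then $G$ contains a subgroup $H$ such that $d_{Haus}(Y,H)<\infty$.
   Context: Every finitely generated group $G$ comes with a fixed finite generating set. $\mathcal{C}(G)$ is its Cayley graph: vertex set $G$, with $g,g'$ joined by an edge iff $g'=gs$ where $s$ or $s^{-1}$ is a generator; edges have length one. $G$ acts on $\mathcal{C}(G)$ by isometries on the left. Subgroups of $G$ are regarded as sets of vertices of $\mathcal{C}(G)$. $d_{Haus}$ is Hausdorff distance in $\mathcal{C}(G)$. In a metric space $X$, for $Y\subseteq X$ and $r\ge 0$, $N_r(Y)=\{x: d(x,Y)\le r\}$ and $B_r(p)=\{x: d(p,x)<r\}$. A uniform neighborhood of $Y$ is a set $N_r(Y)$, $r\ge 0$. A component of $X-Z$ is shallow if it is contained in some uniform neighborhood of $Z$, and deep otherwise. - $Y$ satisfies the shallow condition if there is $m_1\colon\mathbb{R}_{\ge0}\to\mathbb{R}_{\ge0}$ such that for each $r\ge0$, every shallow component of $X-N_r(Y)$ is contained in the $m_1(r)$-neighborhood of $N_r(Y)$. - $Y$ satisfies the deep condition if there is $m_0\colon\mathbb{R}_{\ge0}\to\mathbb{R}_{\ge0}$ such that for each $r\ge0$ and $p\in N_r(Y)$, the ball $B_{m_0(r)}(p)$ meets every deep component of $X-N_r(Y)$. - $Y$ is 3-separating if $X-Y$ has at least three deep components. - If a group $G$ acts on $X$, $Y$ satisfies the noncrossing condition if there is $k>0$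 such that for every two distinct members $Y_1\neq Y_2$ of $\{gY\}_{g\in G}$, $Y_1$ is contained in the $k$-neighborhood of some deep component of $X-Y_2$. *)

(* Defs.v *)
From HB Require Import structures.
From mathcomp Require Import all_boot all_order all_algebra.
From mathcomp Require Import all_classical all_reals all_analysis.
Set Implicit Arguments.
Unset Strict Implicit.
Unset Printing Implicit Defensive.
Import Order.TTheory GRing.Theory Num.Theory.
Local Open Scope classical_set_scope.
Local Open Scope ring_scope.

(** * Coarse separation in metric spaces *)

Section MetricSpace.
Context {R : realType} {X : metricType R}.
Implicit Types (r : R) (x y p : X) (Y Z C : set X).

Lemma edist_mdist x y : edist (x, y) = (mdist x y)%:E.
Proof.
apply/eqP; rewrite eq_le; apply/andP; split.
  apply/lee_addgt0Pr => e e0; rewrite -EFinD; apply: edist_fin => /=.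
    by rewrite ltr_wpDl// mdist_ge0.
  by rewrite ballEmdist/= ltrDl.
apply: le_ereal_inf_tmp => _ [r [_ xyr] <-]; move: xyr; rewrite ballEmdist/= => xyr.
by rewrite lee_fin ltW.
Qed.

(* [edist_inf Y x] is d(x, Y); it is +oo when Y is empty. *)
Definition nbd r Y : set X := [set x | (edist_inf Y x <= r%:E)%E].

Definition components Y : set (set X) := connected_component Y @` Y.

Definition shallow Z C : Prop := exists2 r, 0 <= r & C `<=` nbd r Z.

Definition shallow_component Z C : Prop := components (~` Z) C /\ shallow Z C.

Definition deep_component Z C : Prop := components (~` Z) C /\ ~ shallow Z C.

Definition shallow_condition Y : Prop :=
  exists m1 : {nonneg R} -> {nonneg R},
  forall (r : {nonneg R}) C, shallow_component (nbd r%:num Y) C ->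
    C `<=` nbd (m1 r)%:num (nbd r%:num Y).

Definition deep_condition Y : Prop :=
  exists m0 : {nonneg R} -> {nonneg R},
  forall (r : {nonneg R}) p, nbd r%:num Y p ->
    forall C, deep_component (nbd r%:num Y) C ->
    ball p (m0 r)%:num `&` C !=set0.

Definition three_separating Y : Prop :=
  exists C1 C2 C3,
    [/\ deep_component Y C1, deep_component Y C2 & deep_component Y C3] /\
    [/\ C1 <> C2, C1 <> C3 & C2 <> C3].

Definition translates (G : Type) (act : G -> X -> X) Y : set (set X) :=
  range (fun g => act g @` Y).

Definition noncrossing (G : Type) (act : G -> X -> X) Y : Prop :=
  exists2 k, 0 < k &
  forall Y1 Y2, translates act Y Y1 -> translates act Y Y2 -> Y1 <> Y2 ->
    exists2 C, deep_component Y2 C & Y1 `<=` nbd k C.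

Definition dHaus Y Z : \bar R :=
  ereal_inf [set r%:E | r in [set r | [/\ 0 <= r, Y `<=` nbd r Z &
                                         Z `<=` nbd r Y]]].

End MetricSpace.

(** * Finitely generated groups and their Cayley graphs *)

Structure fgGroupType := FgGroup {
  fg_sort :> groupType;
  gens : seq fg_sort;
  gensP : forall S : {pred fg_sort}, group_closed S -> {subset gens <= S} ->
          forall g, g \in S
}.

(* Cayley graphs are simple: a trivial generator contributes no edge. *)
Definition adj (G : fgGroupType) (g h : G) : Prop :=
  g <> h /\ exists2 s, (s \in gens G) || (s^-1%g \in gens G) & h = (g * s)%g.

Lemma adj_sym (G : fgGroupType) (g h : G) : adj g h -> adj h g.
Proof.
move=> [gh [s sG hE]]; split; first by move/esym.
by exists s^-1%g; rewrite ?invgK 1?orbC// hE mulgK.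
Qed.

Lemma adj_mull (G : fgGroupType) (k g h : G) :
  adj g h -> adj (k * g)%g (k * h)%g.
Proof.
move=> [gh [s sG hE]]; split; first by move/mulgI.
by exists s => //; rewrite hE mulgA.
Qed.

Section CayleyGraph.
Context {R : realType} {G : fgGroupType}.
Implicit Types (g h a b : G) (t l : R).

(* Points of the geometric realization are given by barycentric coordinates
   with respect to the vertices: (1 - t) a + t b on the edge from a to b. *)
Definition barycenter a b t : G -> R :=
  fun g => (1 - t) * (g == a)%:R + t * (g == b)%:R.

Definition realization_point (f : G -> R) : Prop :=
  exists a b t, [/\ a = b \/ adj a b, 0 <= t <= 1 & f = barycenter a b t].

End CayleyGraph.

Record cayley (R : realType) (G : fgGroupType) := Cayley {
  coord :> G -> R;
  coordP : `[< realization_point coord >]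
}.

HB.instance Definition _ R G := [isSub for @coord R G].
HB.instance Definition _ R G := [Choice of cayley R G by <:].

Section CayleyMetric.
Context {R : realType} {G : fgGroupType}.
Implicit Types (g h a b : G) (t l : R) (x y z : cayley R G).

Lemma vertex_subproof g :
  `[< realization_point (fun h : G => (h == g)%:R : R) >].
Proof.
apply/asboolP; exists g, g, 0; split; [by left|by rewrite lexx ler01|].
by apply/funext => h; rewrite /barycenter subr0 mul1r mul0r addr0.
Qed.

Definition vertex g : cayley R G := Cayley (vertex_subproof g).

Definition edge a b : set (cayley R G) :=
  [set x | exists2 t, 0 <= t <= 1 & coord x = barycenter a b t].

Lemma edgeC a b : edge a b = edge b a.
Proof.
suff H c d : edge c d `<=` edge d c by apply/seteqP; split; exact: H.
move=> x [t /andP[t0 t1] xE]; exists (1 - t).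
  by rewrite subr_ge0 t1/= lerBlDr lerDl.
by rewrite xE; apply/funext => g; rewrite /barycenter subKr addrC.
Qed.

Lemma edgeL a b : edge a b (vertex a).
Proof.
exists 0; first by rewrite lexx ler01.
by apply/funext => h; rewrite /barycenter subr0 mul1r mul0r addr0.
Qed.

Lemma edgeR a b : edge a b (vertex b).
Proof. by rewrite edgeC; exact: edgeL. Qed.

(* [path_length x y l]: some piecewise linear path from x to y, made of
   finitely many segments each contained in a closed edge, has length l.  In
   barycentric coordinates the segment from x to y in the edge joining a
   to b has length |x a - y a|. *)
Inductive path_length : cayley R G -> cayley R G -> R -> Prop :=
| path_nil x : path_length x x 0
| path_cons x y z a b l : adj a b -> edge a b x -> edge a b y ->
    path_length y z l -> path_length x z (`|x a - y a| + l).

Definition cayley_dist x y : R := inf [set l | path_length x y l].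

Lemma path_length_ge0 x y l : path_length x y l -> 0 <= l.
Proof. by elim=> // *; rewrite addr_ge0. Qed.

Lemma path_length_trans x y z l m :
  path_length x y l -> path_length y z m -> path_length x z (l + m).
Proof.
elim=> [?|{}x u {}y a b {}l ab xab uab _ IH] yz; first by rewrite add0r.
by rewrite -addrA; apply: (path_cons ab xab uab); exact: IH.
Qed.

Lemma path_length_seg x y a b : adj a b -> edge a b x -> edge a b y ->
  path_length x y `|x a - y a|.
Proof.
move=> ab xab yab; rewrite -[`|_|]addr0.
by apply: (path_cons ab xab yab); exact: path_nil.
Qed.

Lemma path_length_sym x y l : path_length x y l -> path_length y x l.
Proof.
elim=> [?|{}x u {}y a b {}l ab xab uab _ IH]; first exact: path_nil.
rewrite addrC; apply: (path_length_trans IH).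
by rewrite distrC; exact: path_length_seg ab uab xab.
Qed.

Lemma path_length_coord x y l g : path_length x y l -> `|x g - y g| <= l.
Proof.
elim=> [?|{}x u {}y a b {}l [ab _] [t _ xE] [s _ uE] _ IH].
  by rewrite subrr normr0.
apply: (le_trans (ler_distD (u g) _ _)); apply: lerD => //.
rewrite xE uE /barycenter eqxx (negbTE (introN eqP ab)).
rewrite !mulr1 !mulr0 !addr0.
have [->|ga] := eqVneq g a.
  by rewrite (negbTE (introN eqP ab)) !mulr1 !mulr0 !addr0.
have [_|_] := eqVneq g b.
  rewrite !mulr1 !mulr0 !add0r (_ : 1 - t - (1 - s) = s - t) ?(distrC s)//.
  by rewrite opprB addrC addrA subrK.
by rewrite !mulr0 addr0 subrr normr0.
Qed.

Lemma path_length_connected x y : exists l, path_length x y l.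
Proof.
have vert g h : exists l, path_length (vertex g) (vertex h) l.
  pose S : {pred G} := [pred k | `[< forall f : G, exists l,
    path_length (vertex f) (vertex (f * k)%g) l >]].
  have SP k : reflect _ (k \in S) := asboolP _.
  have Scl : group_closed S.
    split; first by apply/SP => f; rewrite mulg1; exists 0; exact: path_nil.
    move=> u v /SP Su /SP Sv; apply/SP => f.
    have [l fu] := Su f; have [m] := Sv (f * (u / v))%g.
    rewrite -!mulgA mulVg mulg1 => fv.
    by exists (l + m); apply: (path_length_trans fu); exact: path_length_sym.
  have SG : {subset gens G <= S}.
    move=> s sG; apply/SP => f; have [ffs|/eqP ffs] := eqVneq f (f * s)%g.
      by rewrite -ffs; exists 0; exact: path_nil.
    have ab : adj f (f * s)%g by split=> //; exists s; rewrite ?sG.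
    by eexists; apply: (path_length_seg ab); [exact: edgeL|exact: edgeR].
  have /SP/(_ g) := gensP Scl SG (g^-1 * h)%g.
  by rewrite mulgA mulgV mul1g.
have tovert z : exists g l, path_length z (vertex g) l.
  have /asboolP[a [b [t [[<-|ab] t01 zE]]]] := coordP z.
    exists a, 0; suff -> : z = vertex a by exact: path_nil.
    apply: val_inj; rewrite /= zE; apply/funext => h.
    by rewrite /barycenter -mulrDl subrK mul1r.
  exists a; eexists; apply: (path_length_seg ab); last exact: edgeL.
  by exists t.
have [g [l xg]] := tovert x; have [h [m yh]] := tovert y.
have [k gh] := vert g h; exists (l + (k + m)).
by apply: (path_length_trans xg); apply: (path_length_trans gh);
   exact: path_length_sym.
Qed.

Lemma has_inf_path_length x y : has_inf [set l | path_length x y l].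
Proof.
split; first by have [l] := path_length_connected x y; exists l.
by exists 0 => l; exact: path_length_ge0.
Qed.

Lemma cayley_distxx x : cayley_dist x x = 0.
Proof.
apply/eqP; rewrite eq_le; apply/andP; split.
  by apply: ge_inf; [case: (has_inf_path_length x x)|exact: path_nil].
by apply: lb_le_inf; [case: (has_inf_path_length x x)|
  move=> l; exact: path_length_ge0].
Qed.

Lemma cayley_dist_coord x y g : `|x g - y g| <= cayley_dist x y.
Proof.
by apply: lb_le_inf; [case: (has_inf_path_length x y)|
  move=> l; exact: path_length_coord].
Qed.

Lemma cayley_dist_positivity x y : cayley_dist x y = 0 -> x = y.
Proof.
move=> xy0; apply: val_inj; apply/funext => g.
by have := cayley_dist_coord x y g; rewrite xy0 normr_le0 subr_eq0 => /eqP.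
Qed.

Lemma cayley_dist_sym x y : cayley_dist x y = cayley_dist y x.
Proof.
by congr inf; apply/seteqP; split=> l; exact: path_length_sym.
Qed.

Lemma cayley_dist_triangle y x z :
  cayley_dist x z <= cayley_dist x y + cayley_dist y z.
Proof.
rewrite -lerBlDr; apply: lb_le_inf; first by case: (has_inf_path_length x y).
move=> l xy; rewrite lerBlDr -lerBlDl.
apply: lb_le_inf; first by case: (has_inf_path_length y z).
move=> m yz; rewrite lerBlDl; apply: ge_inf.
  by case: (has_inf_path_length x z).
exact: path_length_trans xy yz.
Qed.

End CayleyMetric.

HB.instance Definition _ (R : realType) (G : fgGroupType) :=
  isMetric.Build R (cayley R G) (@cayley_distxx R G)
    (@cayley_dist_positivity R G) (@cayley_dist_sym R G)
    (@cayley_dist_triangle R G).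

Section CayleyAction.
Context {R : realType} {G : fgGroupType}.
Implicit Types (g h : G) (x y : cayley R G).

Lemma barycenter_mull g a b (t : R) :
  (fun h : G => barycenter a b t (g^-1 * h)%g) =
  barycenter (g * a)%g (g * b)%g t.
Proof.
have E c (h : G) : (g^-1 * h == c)%g = (h == g * c)%g.
  by apply/eqP/eqP => [<-|->]; rewrite ?mulKg ?mulVKg ?mulKVg.
by apply/funext => h; rewrite /barycenter !E.
Qed.

Lemma cayley_act_subproof g x :
  `[< realization_point (fun h : G => x (g^-1 * h)%g) >].
Proof.
have /asboolP[a [b [t [ab t01 ->]]]] := coordP x; apply/asboolP.
exists (g * a)%g, (g * b)%g, t; rewrite barycenter_mull; split=> //.
by case: ab => [->|ab]; [left|right; exact: adj_mull].
Qed.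

(* The left translation action: it sends (1 - t) a + t b to
   (1 - t) ga + t gb. *)
Definition cayley_act g x : cayley R G := Cayley (cayley_act_subproof g x).

Lemma cayley_act_vertex g h :
  cayley_act g (vertex h) = vertex (g * h)%g :> cayley R G.
Proof.
apply: val_inj; apply/funext => k /=; congr (_%:R); congr nat_of_bool.
by apply/eqP/eqP => [<-|->]; rewrite ?mulKg ?mulVKg ?mulKVg.
Qed.

Lemma cayley_act1 x : cayley_act 1%g x = x.
Proof. by apply: val_inj; apply/funext => h /=; rewrite invg1 mul1g. Qed.

Lemma cayley_actM g h x :
  cayley_act (g * h)%g x = cayley_act g (cayley_act h x).
Proof. by apply: val_inj; apply/funext => k /=; rewrite invgM mulgA. Qed.

Lemma cayley_act_mdist g x y :
  mdist (cayley_act g x) (cayley_act g y) = mdist x y.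
Proof.
have H k u v l :
    path_length u v l -> path_length (cayley_act k u) (cayley_act k v) l.
  elim=> [?|{}u w {}v a b {}l ab [t t01 uE] [s s01 wE] _ IH].
    exact: path_nil.
  have -> : u a - w a = cayley_act k u (k * a)%g - cayley_act k w (k * a)%g.
    by rewrite /= mulKg.
  apply: (path_cons (adj_mull k ab)) IH.
    by exists t => //=; rewrite uE barycenter_mull.
  by exists s => //=; rewrite wE barycenter_mull.
congr inf; apply/seteqP; split=> l; last exact: H.
by move/(H g^-1%g); rewrite -!cayley_actM mulVg !cayley_act1.
Qed.

Definition is_subgraph (Y : set (cayley R G)) : Prop :=
  exists (V : set G) (E : set (G * G)),
    (forall a b, E (a, b) -> [/\ adj a b, V a & V b]) /\
    Y = vertex @` V `|` \bigcup_(e in E) edge e.1 e.2.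

End CayleyAction.

(* Main.v *)
Require Import Defs.
From mathcomp Require Import all_boot all_order all_algebra.
From mathcomp Require Import all_classical all_reals all_analysis.
From mathcomp Require Import lra.

(* Choose three deep components C_a of X - Y and, inside them, deep components
   P_a of X - N_k(Y) and Q_a of X - N_L(Y), where k is the noncrossing constant,
   M = m_0(k) and L = k + M.  If hY <> Y, noncrossing makes hY miss two of the
   P_a; if moreover each P_a meets hC_a, then hY separates these two, and since
   both are M-close to every point of Y, Y lies in N_M(hY).  Call s linked if Q_a meets
   sQ_a for all a.  By induction on word length, every h in the subgroup H
   generated by the linked elements satisfies Q_a <= hC_a and has hY at Hausdorff
   distance at most M from Y; so H lies near Y.  Finite Hausdorff distance between
   Y and hY would not be enough to define H, as the bound would not be uniform.
   Conversely, by the deep condition each y^-1 Q_a, for y a vertex of Y, has a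
   vertex in a fixed finite ball around 1.  If y and z yield the same triple of
   vertices, then y z^-1 is linked, so Y lies near H. *)

Set Implicit Arguments.
Unset Strict Implicit.
Unset Printing Implicit Defensive.
Import Order.TTheory GRing.Theory Num.Theory numFieldNormedType.Exports.
Local Open Scope classical_set_scope.
Local Open Scope ring_scope.

(** * Neighborhoods, and components of their complements *)

Section Neighborhoods.
Context {R : realType} {X : metricType R}.
Implicit Types (r s : R) (x y : X) (A C K Y Z : set X).

Lemma ler_mdistD y x z : mdist x z <= mdist x y + mdist y z.
Proof.
apply/ler_addgt0Pr => e e0; apply/ltW.
have: ball x ((mdist x y + e / 2) + (mdist y z + e / 2)) z.
  by apply: (@ball_triangle _ _ y); rewrite ballEmdist/= ltrDl divr_gt0.
by rewrite addrACA -splitr ballEmdist.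
Qed.

(** The infimum defining d(x, Y) need not be attained, so membership is tested at every radius [s]
    above [r]. *)
Lemma nbdP r Y x :
  nbd r Y x <-> forall s, r < s -> exists2 y, Y y & mdist x y < s.
Proof.
split=> [rYx s rs|h].
  have /ereal_inf_lt[_ [y Yy <-]] : (edist_inf Y x < s%:E)%E.
    by apply: le_lt_trans rYx _; rewrite lte_fin.
  by rewrite edist_mdist lte_fin; exists y.
rewrite /nbd/=; apply/lee_addgt0Pr => e e0.
have [|y Yy xy] := h (r + e); first by rewrite ltrDl.
apply: (@le_trans _ _ (edist (x, y))).
  by apply: ereal_inf_lbound; exists y.
by rewrite edist_mdist lee_fin ltW.
Qed.

Lemma nbdPn r Y x :
  ~ nbd r Y x -> exists2 s, r < s & forall y, mdist x y < s -> ~ Y y.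
Proof.
move=> nx; apply: contrapT => h; apply: nx; apply/nbdP => s rs.
apply: contrapT => h'; apply: h; exists s => // y xy Yy.
by apply: h'; exists y.
Qed.

Lemma nbd_trans r s Y x y :
  mdist x y <= s -> nbd r Y y -> nbd (r + s) Y x.
Proof.
move=> xy /nbdP yY; apply/nbdP => t rt.
have [|z Yz yz] := yY (t - s); first by rewrite ltrBrDr.
exists z => //; apply: (le_lt_trans (ler_mdistD y _ _)).
by rewrite -(subrK s t) addrC ltr_leD.
Qed.

Lemma nbd_nbd r s Y : nbd r (nbd s Y) `<=` nbd (r + s) Y.
Proof.
move=> x /nbdP xY; apply/nbdP => t rst.
have [|y /nbdP yY xy] := xY (r + (t - (r + s)) / 2); first by lra.
have [|z Yz yz] := yY (s + (t - (r + s)) / 2); first by lra.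
by exists z => //; apply: (le_lt_trans (ler_mdistD y _ _)); lra.
Qed.

Lemma nbdS r s Y Z : r <= s -> Y `<=` Z -> nbd r Y `<=` nbd s Z.
Proof.
move=> rs YZ x /nbdP xY; apply/nbdP => t st.
by have [|y /YZ Yy xy] := xY t; [exact: le_lt_trans st|exists y].
Qed.

Lemma nbd_sub r Y : 0 <= r -> Y `<=` nbd r Y.
Proof.
move=> r0 x Yx; apply/nbdP => s rs; exists x => //.
by rewrite mdistxx (le_lt_trans r0).
Qed.

Lemma components_connected A C : components A C -> connected C.
Proof. by move=> [x _ <-]; exact: component_connected. Qed.

Lemma components_sub A C : components A C -> C `<=` A.
Proof. by move=> [x _ <-]; exact: connected_component_sub. Qed.

Lemma components_max A C K : components A C -> connected K -> K `<=` A ->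
  K `&` C !=set0 -> K `<=` C.
Proof.
move=> [x _ <-] cK KA [y [Ky xy]].
by rewrite (same_connected_component xy); exact: connected_component_max.
Qed.

Lemma components_eq A C D : components A C -> components A D ->
  C `&` D !=set0 -> C = D.
Proof.
move=> CA DA CD; apply/seteqP; split.
- by apply: (components_max DA (components_connected CA) _ CD);
    exact: components_sub CA.
- by apply: (components_max CA (components_connected DA)); rewrite 1?setIC//;
    exact: components_sub DA.
Qed.

(** Every separation argument below ends here, with [K] built from paths. *)
Lemma components_bridge A C D K : components A C -> components A D ->
  connected K -> K `<=` A -> K `&` C !=set0 -> K `&` D !=set0 -> C = D.
Proof.
move=> CA DA cK KA KC [z [Kz Dz]]; apply: (components_eq CA DA).
by exists z; split=> //; exact: (components_max CA cK KA KC).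
Qed.

(* If every component of the complement of a larger neighborhood inside C were
   shallow, the shallow condition would bound all of C at once. *)
Lemma deep_component_shrink Y Z C (s : {nonneg R}) : shallow_condition Y ->
  Y `<=` Z -> Z `<=` nbd s%:num Y -> deep_component Z C ->
  exists2 D, deep_component (nbd s%:num Y) D & D `<=` C.
Proof.
move=> [m mP] YZ ZY [ZC nC]; apply: contrapT => h; apply: nC.
exists ((m s)%:num + s%:num); first by [].
suff: C `<=` nbd ((m s)%:num + s%:num) Y.
  by move=> + x Cx => /(_ x Cx); exact: nbdS.
move=> x Cx; have [xY|nxY] := pselect (nbd s%:num Y x).
  by apply: nbdS xY => //; rewrite lerDr.
set D := connected_component (~` nbd s%:num Y) x.
have cD : components (~` nbd s%:num Y) D by exists x.
have Dx : D x by exact: connected_component_refl.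
have DC : D `<=` C.
  apply: (components_max ZC (components_connected cD)); last by exists x.
  by move=> y /(components_sub cD) ny /ZY.
apply: nbd_nbd; apply: (mP s D) Dx; split=> //.
by apply: contrapT => nD; apply: h; exists D.
Qed.

End Neighborhoods.

Lemma short_map_continuous (R : realType) (X Z : metricType R) (f : X -> Z) :
  (forall x y, mdist (f x) (f y) <= mdist x y) -> continuous f.
Proof.
move=> fS x; apply/cvg_ballP => e e0; apply/nbhs_ballP; exists e => // y.
by rewrite /= !ballEmdist /=; exact: le_lt_trans.
Qed.

(** * Paths in the Cayley graph as connected sets *)

Section CayleyPaths.
Context {R : realType} {G : fgGroupType}.
Implicit Types (g h a b : G) (s t l : R) (x y z : cayley R G).

Lemma path_length_mdist x y l : path_length x y l -> mdist x y <= l.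
Proof. by move=> xy; apply: ge_inf => //; case: (has_inf_path_length x y). Qed.

Lemma mdist_path_length x y l :
  mdist x y < l -> exists2 m, path_length x y m & m < l.
Proof. by move=> /(inf_lt (proj1 (has_inf_path_length x y)))[m]; exists m. Qed.

Lemma barycenterL a b t : a <> b -> barycenter a b t a = 1 - t.
Proof.
by move=> /eqP/negbTE ab; rewrite /barycenter eqxx ab mulr1 mulr0 addr0.
Qed.

(** Truncation to [0, 1] makes the parametrization of an edge total on the real line, where its
    continuity needs no subspace topology. *)
Definition clip t : R := Num.min 1 (Num.max 0 t).

Lemma clip01 t : 0 <= clip t <= 1.
Proof. by rewrite /clip le_min ler01 le_max lexx ge_min lexx. Qed.

Lemma clip_id t : 0 <= t <= 1 -> clip t = t.
Proof. by move=> /andP[t0 t1]; rewrite /clip max_r// min_r. Qed.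

Lemma clip_lipschitz s t : `|clip s - clip t| <= `|s - t|.
Proof.
rewrite ler_norml /clip; have := ler_norm (s - t).
have := ler_norm (t - s); rewrite distrC => ts st.
by case: (leP 0 s) => s0; case: (leP 0 t) => t0; rewrite ?(min_r ler01);
  try (case: (leP 1 s) => s1); try (case: (leP 1 t) => t1); apply/andP;
  split; lra.
Qed.

Lemma edge_point_subproof a b t : adj a b ->
  `[< realization_point (barycenter a b (clip t)) >].
Proof.
by move=> ab; apply/asboolP; exists a, b, (clip t); split=> //;
  [right|exact: clip01].
Qed.

Definition edge_point a b (ab : adj a b) t : cayley R G :=
  Cayley (edge_point_subproof t ab).

Lemma edge_point_edge a b (ab : adj a b) t : edge a b (edge_point ab t).
Proof. by exists (clip t); first exact: clip01. Qed.

Lemma edge_pointE a b (ab : adj a b) t x :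
  0 <= t <= 1 -> x = barycenter a b t :> (G -> R) -> edge_point ab t = x.
Proof. by move=> t01 xE; apply: val_inj; rewrite /= clip_id. Qed.

Lemma edge_point_lipschitz a b (ab : adj a b) s t :
  mdist (edge_point ab s) (edge_point ab t) <= `|s - t|.
Proof.
apply: (le_trans (path_length_mdist (path_length_seg ab
  (edge_point_edge ab s) (edge_point_edge ab t)))).
rewrite /= !barycenterL; try by case: ab.
by rewrite opprB addrC addrA subrK distrC clip_lipschitz.
Qed.

Lemma edge_point_continuous a b (ab : adj a b) : continuous (edge_point ab).
Proof.
move=> t; apply/cvg_ballP => e e0; apply/nbhs_ballP; exists e => // s ts.
rewrite /= ballEmdist /=.
by apply: le_lt_trans (edge_point_lipschitz _ _ _) ts.
Qed.

Lemma edge_segment x y a b : adj a b -> edge a b x -> edge a b y ->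
  exists2 K : set (cayley R G), connected K &
    [/\ K x, K y & forall z, K z -> mdist x z <= `|x a - y a|].
Proof.
move=> ab [t t01 xE] [s s01 yE].
have [ts|st] := leP t s.
  exists (edge_point ab @` `[t, s]).
    apply: connected_continuous_connected; first exact: segment_connected.
    exact/continuous_subspaceT/edge_point_continuous.
  split.
  - by exists t; [rewrite /= in_itv/= lexx|exact: edge_pointE].
  - by exists s; [rewrite /= in_itv/= lexx andbT|exact: edge_pointE].
  - move=> _ [u + <-]; rewrite /= in_itv/= => /andP[tu us].
    rewrite -{1}(edge_pointE ab t01 xE).
    apply: (le_trans (edge_point_lipschitz _ _ _)).
    rewrite xE yE !barycenterL; try by case: ab.
    by rewrite ler0_norm ?ger0_norm; lra.
exists (edge_point ab @` `[s, t]).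
  apply: connected_continuous_connected; first exact: segment_connected.
  exact/continuous_subspaceT/edge_point_continuous.
split.
- by exists t; [rewrite /= in_itv/= lexx ltW|exact: edge_pointE].
- by exists s; [rewrite /= in_itv/= lexx ltW|exact: edge_pointE].
- move=> _ [u + <-]; rewrite /= in_itv/= => /andP[su ut].
  rewrite -{1}(edge_pointE ab t01 xE).
  apply: (le_trans (edge_point_lipschitz _ _ _)).
  rewrite xE yE !barycenterL; try by case: ab.
  by rewrite ger0_norm ?ler0_norm; lra.
Qed.

Lemma path_length_connected_set x y l : path_length x y l ->
  exists2 K : set (cayley R G), connected K &
    [/\ K x, K y & forall z, K z -> mdist x z <= l].
Proof.
elim=> [{}x|{}x u {}y a b {}l ab xab uab _ [K cK [Ku Ky Kl]]].
  exists [set x]; first exact: connected1.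
  by split=> // z ->; rewrite mdistxx.
have [S cS [Sx Su Sl]] := edge_segment ab xab uab.
exists (S `|` K); first by apply: connectedU => //; exists u.
split; [by left|by right|move=> z [Sz|Kz]].
  apply: (le_trans (Sl z Sz)); rewrite lerDl.
  by apply: le_trans (Kl u Ku); exact: mdist_ge0.
by apply: (le_trans (ler_mdistD u _ _)); rewrite lerD ?Sl ?Kl.
Qed.

(** Distance is an infimum of path lengths, so the strict bound yields an actual path shorter than
    [l]. This replaces the use of geodesics. *)
Lemma connected_in_ball x y l : mdist x y < l ->
  exists2 K : set (cayley R G), connected K &
    [/\ K x, K y & forall z, K z -> mdist x z < l].
Proof.
move=> /mdist_path_length[m /path_length_connected_set[K cK [Kx Ky Km]] ml].
by exists K => //; split=> // z /Km/le_lt_trans; exact.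
Qed.

Lemma edge_mdist a b x : adj a b -> edge a b x -> mdist x (vertex a) <= 1.
Proof.
move=> ab xab.
apply: (le_trans (path_length_mdist (path_length_seg ab xab (edgeL a b)))).
case: xab => t /andP[t0 t1] ->; rewrite barycenterL/= ?eqxx; last by case: ab.
by rewrite [1 - t - _]addrAC subrr sub0r normrN ger0_norm//.
Qed.

Lemma near_vertex x : exists a, mdist x (vertex a) <= 1.
Proof.
have /asboolP[a [b [t [[<-|ab] t01 xE]]]] := coordP x; exists a.
  suff -> : x = vertex a by rewrite mdistxx.
  apply: val_inj; rewrite /= xE; apply/funext => h.
  by rewrite /barycenter -mulrDl subrK mul1r.
by apply: (edge_mdist ab); exists t.
Qed.

End CayleyPaths.

(** * Metric balls contain finitely many vertices *)

Section WordBalls.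
Context {G : fgGroupType}.

Fixpoint word_ball n : seq G :=
  if n is m.+1 then
    word_ball m ++ [seq b * s | b <- word_ball m, s <- gens G]%g ++
      [seq b / s | b <- word_ball m, s <- gens G]%g
  else [:: 1%g].

Lemma word_ball_adj n (a b : G) :
  adj a b -> a \in word_ball n -> b \in word_ball n.+1.
Proof.
move=> [_ [s sG ->]] an /=; rewrite !mem_cat; apply/orP; right; apply/orP.
case/orP: sG => sG; [left|right]; apply/allpairsP.
  by exists (a, s).
by exists (a, s^-1%g); split=> //=; rewrite invgK.
Qed.

Lemma word_ball_le m n : (m <= n)%N -> {subset word_ball m <= word_ball n}.
Proof.
move=> /subnK <-; elim: (n - m)%N => // k IH g /IH gk.
by rewrite addSn /= mem_cat gk.
Qed.

(** This is max(0, N - |g|) for the word length |g|: a finitely supported function on the vertices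
    that changes by at most one along an edge. *)
Definition word_weight N (g : G) : nat := \sum_(n < N) (g \in word_ball n).

Lemma word_weight1 N : word_weight N 1%g = N.
Proof.
rewrite -[RHS]card_ord -sum1_card; apply: eq_bigr => n _.
by rewrite (@word_ball_le 0)// inE.
Qed.

Lemma word_weight_out N g : g \notin word_ball N -> word_weight N g = 0%N.
Proof.
move=> gN; apply: big1 => n _; apply/eqP; rewrite eqb0.
by apply: contra gN; apply: word_ball_le; exact: ltnW.
Qed.

(** If [a] is in the ball of radius n, then [b] is in the one of radius n + 1. Shifting the index
    thus loses only the last term of the sum. *)
Lemma word_weight_adj N a b : adj a b ->
  (word_weight N a <= (word_weight N b).+1)%N.
Proof.
move=> ab; case: N => [|N]; first by rewrite /word_weight big_ord0.
rewrite {1}/word_weight big_ord_recr /= -addn1 leq_add ?leq_b1//.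
rewrite /word_weight big_ord_recl; apply: leq_trans (leq_addl _ _).
apply: leq_sum => n _; rewrite lift0.
by case: (boolP (a \in _)) => // /(word_ball_adj ab) ->.
Qed.

Context {R : realType}.
Implicit Types (x y : cayley R G).

Lemma sum_delta (w : G -> R) (F : seq G) a : uniq F ->
  (forall g, g \notin F -> w g = 0) -> \sum_(g <- F) w g * (g == a)%:R = w a.
Proof.
move=> uF w0; have [aF|aF] := boolP (a \in F); last first.
  rewrite w0// big_seq big1// => g gF.
  by case: eqVneq gF => [->|_ _]; [rewrite (negbTE aF)|rewrite mulr0].
rewrite (bigD1_seq a)//= eqxx mulr1 big1 ?addr0// => g /negbTE ->.
by rewrite mulr0.
Qed.

(* The sum evaluates the piecewise linear extension of w at a point. *)
Lemma sum_barycenter (w : G -> R) (F : seq G) a b (t : R) : uniq F ->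
  (forall g, g \notin F -> w g = 0) ->
  \sum_(g <- F) w g * barycenter a b t g = (1 - t) * w a + t * w b.
Proof.
move=> uF w0; rewrite -!(sum_delta _ uF w0) !mulr_sumr -big_split/=.
by apply: eq_bigr => g _; rewrite mulrDr !(mulrCA (w g)).
Qed.

(** On a segment inside an edge, the extension of [w] changes by the length of the segment times |w
    a - w b|, hence by at most that length. *)
Lemma path_length_sum (w : G -> R) (F : seq G) x y l : uniq F ->
  (forall g, g \notin F -> w g = 0) ->
  (forall a b, adj a b -> `|w a - w b| <= 1) -> path_length x y l ->
  `|\sum_(g <- F) w g * x g - \sum_(g <- F) w g * y g| <= l.
Proof.
move=> uF w0 w1; elim=> [z|{}x u z a b {}l ab [t _ xE] [s _ uE] _ IH].
  by rewrite subrr normr0.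
apply: (le_trans (ler_distD (\sum_(g <- F) w g * u g) _ _)); apply: lerD => //.
rewrite xE uE !sum_barycenter// !barycenterL; try by case: ab.
have -> : (1 - t) * w a + t * w b - ((1 - s) * w a + s * w b) =
  (1 - t - (1 - s)) * (w a - w b) by lra.
by rewrite normrM ler_piMr// w1.
Qed.

(** The extension of [word_weight] is N at 1 and 0 at a vertex outside the word ball, so a path
    joining them has length at least N. *)
Lemma ball_word_ball N g :
  mdist (vertex 1%g : cayley R G) (vertex g) < N%:R -> g \in word_ball N.
Proof.
move=> /mdist_path_length[l path1g lN]; apply: contraLR lN => gN.
pose w h : R := (word_weight N h)%:R.
have w0 h : h \notin undup (word_ball N) -> w h = 0.
  by rewrite mem_undup /w => /word_weight_out ->.
have w1 a b : adj a b -> `|w a - w b| <= 1.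
  move=> ab; have := word_weight_adj N ab.
  have := word_weight_adj N (adj_sym ab).
  rewrite -2!(ler_nat R) -!natr1 -/(w a) -/(w b) => ba ab'.
  by rewrite ler_norml; apply/andP; split; lra.
have := path_length_sum (undup_uniq _) w0 w1 path1g.
rewrite /= !sum_delta ?undup_uniq// /w word_weight1 word_weight_out//.
by rewrite subr0 normr_nat leNgt.
Qed.

End WordBalls.

Local Notation "g *: A" := (cayley_act g @` A).

(** * Left translates of sets, neighborhoods and components *)

Section Translates.
Context {R : realType} {G : fgGroupType}.
Implicit Types (g h : G) (r : R) (x y : cayley R G) (A C K Y : set (cayley R G)).

Lemma cayley_actK g : cancel (@cayley_act R G g) (cayley_act g^-1%g).
Proof. by move=> x; rewrite -cayley_actM mulVg cayley_act1. Qed.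

Lemma cayley_actVK g : cancel (@cayley_act R G g^-1%g) (cayley_act g).
Proof. by move=> x; rewrite -cayley_actM mulgV cayley_act1. Qed.

Lemma translateM g h A : (g * h)%g *: A = g *: (h *: A).
Proof.
by rewrite image_comp; apply: eq_imagel => x _; rewrite cayley_actM.
Qed.

Lemma translate1 A : 1%g *: A = A.
Proof.
rewrite -[RHS]image_id; apply: eq_imagel => x _; exact: cayley_act1.
Qed.

Lemma translateE g A x : (g *: A) x <-> A (cayley_act g^-1%g x).
Proof.
split=> [[y Ay <-]|Ax]; first by rewrite cayley_actK.
by exists (cayley_act g^-1%g x) => //; rewrite cayley_actVK.
Qed.

Lemma cayley_act_continuous g : continuous (@cayley_act R G g).
Proof.
by apply: short_map_continuous => x y; rewrite cayley_act_mdist.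
Qed.

Lemma translate_connected g K : connected K -> connected (g *: K).
Proof.
move=> cK; apply: connected_continuous_connected cK _.
exact/continuous_subspaceT/cayley_act_continuous.
Qed.

Lemma translate_nbd g r Y : g *: nbd r Y = nbd r (g *: Y).
Proof.
have sub h Z : h *: nbd r Z `<=` nbd r (h *: Z).
  move=> _ [x /nbdP xZ <-]; apply/nbdP => s /xZ[y Zy xy].
  by exists (cayley_act h y); [exists y|rewrite cayley_act_mdist].
apply/seteqP; split=> [|x]; first exact: sub.
move=> gx; apply/translateE; rewrite -[Y]translate1 -(mulVg g) translateM.
by apply: sub; exists x.
Qed.

Lemma translate_components g A C :
  components A C -> components (g *: A) (g *: C).
Proof.
move=> AC'; have [x Ax xC] := AC'.
have Cx : C x by rewrite -xC; exact: connected_component_refl.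
have gAx : (g *: A) (cayley_act g x) by exists x.
exists (cayley_act g x) => //; set D := connected_component _ _.
have gAD : components (g *: A) D by exists (cayley_act g x).
have Dx : D (cayley_act g x) by exact: connected_component_refl.
apply/seteqP; split; last first.
  apply: (components_max gAD).
  - exact/translate_connected/(components_connected AC').
  - exact/image_subset/(components_sub AC').
  - by exists (cayley_act g x); split=> //; exists x.
move=> y Dy; apply/translateE.
apply: (components_max AC' (K := g^-1%g *: D)); last by exists y.
- exact/translate_connected/(components_connected gAD).
- by move=> _ [z /(components_sub gAD)/translateE Az <-].
- by exists x; split=> //; exists (cayley_act g x); rewrite ?cayley_actK.
Qed.

Lemma translate_setC g A : g *: (~` A) = ~` (g *: A).
Proof.
by apply/seteqP; split=> x; rewrite /setC /= => h; last apply/translateE;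
  [move: h => /translateE h /translateE|move=> /translateE].
Qed.

End Translates.

(** * The subgroup generated by a symmetric set *)

Section GeneratedSubgroup.
Context {G : groupType} (S : set G) (SV : forall s, S s -> S s^-1%g).

(** Letters come from [S] alone: by [SV] it already contains their inverses. The length is recorded
    for later inductions. *)
Fixpoint word n (g : G) : Prop :=
  if n is m.+1 then exists s h, [/\ S s, word m h & g = (s * h)%g]
  else g = 1%g.

Lemma wordM m n g h : word m g -> word n h -> word (m + n) (g * h)%g.
Proof.
elim: m g => [g /= -> nh|m IH _ [s [g [Ss mg ->]]] nh]; first by rewrite mul1g.
by exists s, (g * h)%g; split; [|exact: IH|rewrite mulgA].
Qed.

Lemma wordV n g : word n g -> word n g^-1%g.
Proof.
elim: n g => [g /= ->|n IH _ [s [g [Ss ng ->]]]]; first by rewrite invg1.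
rewrite -addn1 invgM; apply: wordM; first exact: IH.
by exists s^-1%g, 1%g; split; [exact: SV| |rewrite mulg1].
Qed.

Definition generated : {pred G} := [pred g | `[< exists n, word n g >]].

Lemma generatedP g : reflect (exists n, word n g) (g \in generated).
Proof. exact: asboolP. Qed.

Lemma generated_closed : group_closed generated.
Proof.
split=> [|g h /generatedP[m mg] /generatedP[n nh]]; apply/generatedP.
  by exists 0%N.
by exists (m + n)%N; apply: wordM => //; exact: wordV.
Qed.

End GeneratedSubgroup.

(** * Elements that keep Y uniformly close to itself *)

Section CoarseStabilizer.
Context {R : realType} {G : fgGroupType} (Y : set (cayley R G)) (k M : R).
Context (C P Q : 'I_3 -> set (cayley R G)).
Context (M0 : 0 <= M).
Context (nc : forall h, h *: Y <> Y ->
  exists2 D, deep_component Y D & h *: Y `<=` nbd k D).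
Context (Cinj : injective C) (Ccomp : forall a, components (~` Y) (C a)).
Context (Pconn : forall a, connected (P a)) (PC : forall a, P a `<=` C a).
Context (Pfar : forall a, P a `<=` ~` nbd k Y).
Context (Pnear : forall a y, Y y -> exists2 p, P a p & mdist y p < M).
Context (Qconn : forall a, connected (Q a)) (QP : forall a, Q a `<=` P a).
Context (Qfar : forall a, Q a `<=` ~` nbd M Y).
Implicit Types (g h s : G) (a b : 'I_3) (x y z : cayley R G).

(** A point of P_a on hY would have a point of [D] at distance less than some s > k, while Y stays
    at distance at least s. A path between the two points would then join C_a to [D] outside Y. *)
Lemma noncrossing_avoid h D a : components (~` Y) D -> h *: Y `<=` nbd k D ->
  C a <> D -> P a `<=` ~` (h *: Y).
Proof.
move=> YD hYD CD x Px hYx; apply: CD.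
have [s ks sY] := nbdPn (Pfar Px).
have [d Dd xd] := (nbdP _ _ _).1 (hYD x hYx) s ks.
have [K cK [Kx Kd Ks]] := connected_in_ball xd.
apply: (components_bridge (Ccomp a) YD cK).
- by move=> z /Ks/sY.
- by exists x; split=> //; exact: PC.
- by exists d.
Qed.

(** Noncrossing puts hY near a single component, and at most one of the three distinct C_a equals
    it. *)
Lemma noncrossing_avoid2 h : h *: Y <> Y -> exists a b,
  [/\ a <> b, P a `<=` ~` (h *: Y) & P b `<=` ~` (h *: Y)].
Proof.
move=> hY; have [D [YD _] hYD] := nc hY.
have avoid a : C a <> D -> P a `<=` ~` (h *: Y) := noncrossing_avoid YD hYD.
pose i0 : 'I_3 := ord0; pose i1 : 'I_3 := inord 1; pose i2 : 'I_3 := inord 2.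
have neq a b : a <> b -> C a = D -> C b <> D.
  by move=> ab aD bD; apply: ab; apply: Cinj; rewrite aD.
have i01 : i0 <> i1 by move=> /(congr1 val); rewrite /= inordK.
have i02 : i0 <> i2 by move=> /(congr1 val); rewrite /= inordK.
have i12 : i1 <> i2 by move=> /(congr1 val); rewrite /= !inordK.
have [e0|n0] := pselect (C i0 = D).
  by exists i1, i2; split=> //; apply: avoid; exact: neq e0.
have [e1|n1] := pselect (C i1 = D).
  by exists i0, i2; split=> //; apply: avoid => //; exact: neq e1.
by exists i0, i1; split=> //; exact: avoid.
Qed.

(* Two of the P a avoid hY and lie in distinct components of its complement;
   each comes close to every point of Y, so hY has to pass in between. *)
Lemma sub_nbd_translate h : (forall a, P a `&` (h *: C a) !=set0) ->
  Y `<=` nbd M (h *: Y).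
Proof.
move=> PhC; have [->|/noncrossing_avoid2[a [b [ab aY bY]]]] :=
  pselect (h *: Y = Y); first exact: nbd_sub.
move=> y Yy; apply: contrapT => /nbdPn[s Ms sY].
have comp c : components (~` (h *: Y)) (h *: C c).
  by rewrite -translate_setC; exact: translate_components.
have PhC' c : P c `<=` ~` (h *: Y) -> P c `<=` h *: C c.
  by move=> cY; exact: (components_max (comp c)).
have near c : P c `<=` ~` (h *: Y) -> exists2 K : set (cayley R G),
    connected K & [/\ K `<=` ~` (h *: Y), K y & K `&` (h *: C c) !=set0].
  move=> cY; have [p Pp yp] := Pnear c Yy.
  have [K cK [Ky Kp Ks]] := connected_in_ball (lt_trans yp Ms).
  exists K => //; split=> // [z /Ks/sY//|]; exists p; split=> //.
  exact: PhC' Pp.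
have [K cK [KY Ky Ka]] := near a aY; have [L cL [LY Ly Lb]] := near b bY.
have Cab : h *: C a = h *: C b.
  apply: (components_bridge (comp a) (comp b) (K := K `|` L)).
  - by apply: connectedU => //; exists y.
  - by move=> z [/KY|/LY].
  - by case: Ka => z [Kz Cz]; exists z; split=> //; left.
  - by case: Lb => z [Lz Cz]; exists z; split=> //; right.
apply/ab/Cinj; rewrite -[LHS]translate1 -[RHS]translate1 -(mulVg h).
by rewrite !translateM Cab.
Qed.

(** Having Q_a on both sides makes the condition invariant under inversion. *)
Definition linked : set G := [set s | forall a, Q a `&` (s *: Q a) !=set0].

Lemma linkedV s : linked s -> linked s^-1%g.
Proof.
move=> sQ a; have [x [Qx /translateE Qsx]] := sQ a.
by exists (cayley_act s^-1%g x); split=> //; exists x.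
Qed.

(* A translate known to be close to Y misses all the Q a, which is what lets
   the links along a word be followed from one translate to the next. *)
Lemma word_linked n h : word linked n h ->
  [/\ Y `<=` nbd M (h *: Y), h *: Y `<=` nbd M Y &
      forall a, Q a `<=` h *: C a].
Proof.
elim: n h => [_ ->|n IH h nh].
  rewrite translate1; split=> [||a x /QP/PC]; try exact: nbd_sub.
  by rewrite translate1.
(* Write g = sg'. By induction Q_a lies in g'C_a, so sQ_a lies in gC_a, and Q_a meets sQ_a. *)
have QC g : word linked n.+1 g -> forall a, Q a `&` (g *: C a) !=set0.
  move=> [s [g' [sQ /IH[_ _ QC] ->]]] a.
  have [x [Qx [x' Qx' xE]]] := sQ a.
  exists x; split=> //; rewrite translateM -xE; exists x' => //.
  exact: QC.
have Ynear g : word linked n.+1 g -> Y `<=` nbd M (g *: Y).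
  move=> /QC gQC; apply: sub_nbd_translate => a.
  by have [x [/QP Px Cx]] := gQC a; exists x.
(* The inverse of [h] is a word of the same length, so Y is M-close to its translate by it; now
   translate by [h]. *)
have hY : h *: Y `<=` nbd M Y.
  move=> _ [y /(Ynear _ (wordV linkedV nh)) hy <-].
  rewrite -[Y]translate1 -(mulgV h) translateM -translate_nbd.
  by exists y.
split=> // [|a]; first exact: Ynear.
apply: (@components_max _ _ (~` (h *: Y))) => //.
- by rewrite -translate_setC; exact: translate_components.
- by move=> x Qx /hY; exact: Qfar Qx.
- exact: QC.
Qed.

End CoarseStabilizer.

(** * Vertices in deep components, and the pigeonhole argument *)

Section Pigeonhole.
Context {R : realType} {G : fgGroupType}.
Implicit Types (Y C D : set (cayley R G)).

(* A deep component two units further from Y meets a fixed ball around y, and a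
   vertex next to a point in the intersection still lies in D. *)
Lemma deep_component_vertex Y C (s : R) (t : {nonneg R}) (y : cayley R G) m D :
  s + 2 <= t%:num -> components (~` nbd s Y) D -> C `<=` D ->
  C `<=` ~` nbd t%:num Y -> ball y m `&` C !=set0 ->
  exists2 c, D (vertex c) & mdist y (vertex c) < m + 1.
Proof.
move=> st sD CD Ct [x [+ Cx]]; rewrite ballEmdist /= => yx.
have [c xc] := near_vertex x; exists c; last first.
  by apply: (le_lt_trans (ler_mdistD x _ _)); rewrite ltr_leD.
have [|K cK [Kx Kc K2]] := @connected_in_ball _ _ x (vertex c) 2.
  by apply: le_lt_trans xc _; rewrite ltr1n.
apply: (components_max sD cK) Kc; last by exists x; split=> //; exact: CD.
move=> z Kz zY; apply: (Ct _ Cx); apply: (nbdS st (@subset_refl _ Y)).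
by apply: nbd_trans zY; exact/ltW/K2.
Qed.

(** A type picks, for each a, an element v of [F] with yv in Q_a. There are finitely many types. If
    y and z share one, then yv = (y/z)(zv) shows that y/z is in [H], and its distance to y is d(1,
    z^-1), which depends only on the chosen z. *)
Lemma vertex_linked_bound (n : nat) (Q : 'I_n -> set (cayley R G))
    (F : seq G) (V H : set G) :
  (forall y z, V y -> V z -> (forall a, Q a `&` ((y / z)%g *: Q a) !=set0) ->
    H (y / z)%g) ->
  (forall y, V y -> forall a, exists2 v, v \in F & Q a (vertex (y * v)%g)) ->
  exists2 r, 0 <= r & @vertex R G @` V `<=` nbd r (@vertex R G @` H).
Proof.
move=> VH VF; pose T := {ffun 'I_n -> seq_sub F}.
pose type (t : T) y := V y /\ forall a, Q a (vertex (y * ssval (t a))%g).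
have bound (t : T) : exists r, forall y, type t y ->
    nbd r (@vertex R G @` H) (vertex y : cayley R G).
  have [[z [Vz tz]]|nz] := pselect (exists z, type t z); last first.
    (* No vertex has this type, so any radius serves. *)
    by exists 0 => y ty; case: nz; exists y.
  exists (mdist (vertex 1%g : cayley R G) (vertex z^-1%g)) => y [Vy ty].
  apply/nbdP => s; exists (vertex (y / z)%g).
    exists (y / z)%g => //; apply: VH => // a.
    exists (vertex (y * ssval (t a))%g); split=> //.
    exists (vertex (z * ssval (t a))%g) => //.
    by rewrite cayley_act_vertex mulgA mulgVK.
  by rewrite -[y in vertex y]mulg1 -!cayley_act_vertex cayley_act_mdist.
have [r rP] := choice bound.
exists (\big[Num.max/0]_t r t); first exact: bigmax_ge_id.
move=> _ [y Vy <-].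
have /choice[u uP] : forall a, exists v : seq_sub F,
    Q a (vertex (y * ssval v)%g).
  by move=> a; have [v vF Qv] := VF y Vy a; exists (SeqSub vF).
apply: (nbdS (r := r [ffun a => u a]) _ (@subset_refl _ _)).
  exact: le_bigmax.
by apply: rP; split=> // a; rewrite ffunE.
Qed.

Lemma dHaus_lty Y D r : 0 <= r -> Y `<=` nbd r D -> D `<=` nbd r Y ->
  (dHaus Y D < +oo)%E.
Proof.
move=> r0 YD DY; apply: le_lt_trans (ltry r).
by apply: ereal_inf_lbound; exists r.
Qed.

Lemma subgraph_near_vertex Y y : is_subgraph Y -> Y y ->
  exists2 v, Y (vertex v) & mdist y (vertex v) <= 1.
Proof.
move=> [V [E [EV ->]]] [[v Vv <-]|[[a b] Eab yab]].
  by exists v; [left; exists v|rewrite mdistxx].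
have [ab Va Vb] := EV _ _ Eab; exists a; first by left; exists a.
exact: edge_mdist yab.
Qed.

(** If Y were empty, its complement would be the whole Cayley graph, which is connected. *)
Lemma separating_neq0 Y C D : components (~` Y) C -> components (~` Y) D ->
  C <> D -> Y !=set0.
Proof.
move=> YC YD CD; apply: contrapT => /nonemptyPn Y0; apply: CD.
have [x Cx] : C !=set0.
  by case: YC => x Yx <-; exists x; exact: connected_component_refl.
have [y Dy] : D !=set0.
  by case: YD => y Yy <-; exists y; exact: connected_component_refl.
have [|K cK [Kx Ky _]] := @connected_in_ball _ _ x y (mdist x y + 1).
  by rewrite ltrDl.
apply: (components_bridge YC YD cK).
- by rewrite Y0 setC0.
- by exists x.
- by exists y.
Qed.

End Pigeonhole.

(** * Choice of the nested components, and the two Hausdorff bounds *)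

Theorem theorem4p3 (R : realType) (G : fgGroupType) (Y : set (cayley R G))
  (Ysub : is_subgraph Y)
  (Ydeep : deep_condition Y)
  (Yshallow : shallow_condition Y)
  (Y3sep : three_separating Y)
  (Ync : noncrossing cayley_act Y) :
  exists2 H : {pred G}, group_closed H &
    (dHaus Y [set vertex h | h in [set` H]] < +oo)%E.
Proof.
have [C1 [C2 [C3 [[dC1 dC2 dC3] [C12 C13 C23]]]]] := Y3sep.
have [k k0 nc] := Ync; have [m mP] := Ydeep.
pose C (a : 'I_3) := nth C1 [:: C1; C2; C3] a.
have Cdeep a : deep_component Y (C a) by case: a => -[|[|[|]]].
have Cinj : injective C.
  by move=> [[|[|[|?]]] ?] [[|[|[|?]]] ?]; rewrite /C //= => ?;
    apply: val_inj => //=; exfalso; auto.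
pose kn := NngNum (ltW k0); pose M := (m kn)%:num.
have M0 : 0 <= M by rewrite /M.
have L0 : 0 <= k + M := addr_ge0 (ltW k0) M0.
pose Ln := NngNum L0; pose Tn := NngNum (addr_ge0 L0 (ler0n R 2)).
have YY s : Y `<=` nbd (s : {nonneg R})%:num Y by exact: nbd_sub.
have /choice[P PP] a : exists D, deep_component (nbd k Y) D /\ D `<=` C a.
  have [D ? ?] := deep_component_shrink Yshallow (@subset_refl _ _) (YY kn)
    (Cdeep a).
  by exists D.
(* The radius k + M is at least k, so shrinking applies inside P_a, and at least M, so Q_a misses
   N_M(Y). *)
have /choice[Q QP] a : exists D,
    deep_component (nbd (k + M) Y) D /\ D `<=` P a.
  have [|D ? ?] := deep_component_shrink (s := Ln) Yshallow (YY kn) _ (PP a).1.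
    by apply: nbdS => //=; rewrite lerDl.
  by exists D.
(* S_a lies two units deeper, which leaves room to move from a point of S_a to a vertex of Q_a. *)
have /choice[S SP] a : exists D,
    deep_component (nbd (k + M + 2) Y) D /\ D `<=` Q a.
  have [|D ? ?] := deep_component_shrink (s := Tn) Yshallow (YY Ln) _ (QP a).1.
    by apply: nbdS => //=; rewrite lerDl.
  by exists D.
have ncY h : h *: Y <> Y ->
    exists2 D, deep_component Y D & h *: Y `<=` nbd k D.
  by apply: nc; [exists h|exists 1%g => //; exact: translate1].
have Pnear a y : Y y -> exists2 p, P a p & mdist y p < M.
  move=> Yy; have [p [+ Pp]] := mP kn y (YY kn _ Yy) (P a) (PP a).1.
  by rewrite ballEmdist; exists p.
have Pfar a : P a `<=` ~` nbd k Y := components_sub (PP a).1.1.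
have Qfar a : Q a `<=` ~` nbd M Y.
  move=> x /(components_sub (QP a).1.1) xL xM; apply: xL.
  by apply: nbdS xM => //; rewrite lerDr ltW.
have conn a : connected (P a) := components_connected (PP a).1.1.
have connQ a : connected (Q a) := components_connected (QP a).1.1.
have wordY := word_linked M0 ncY Cinj (fun a => (Cdeep a).1) conn
  (fun a => (PP a).2) Pfar Pnear connQ (fun a => (QP a).2) Qfar.
pose H := generated (linked Q); exists H.
  exact/generated_closed/linkedV.
pose V : set G := [set v | Y (vertex v)].
have [r r0 VH] : exists2 r : R, 0 <= r &
    @vertex R G @` V `<=` nbd r (@vertex R G @` [set` H]).
  (* The deep condition at radius k + M + 2 gives the first term; the 1 pays for moving to a
     vertex. *)
  pose N := Num.bound ((m Tn)%:num + 1).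
  apply: (vertex_linked_bound (Q := Q) (F := word_ball N)).
    move=> y z _ _ yz; apply/generatedP; exists 1%N, (y / z)%g, 1%g.
    by split=> //; rewrite mulg1.
  move=> y Vy a; have yT := mP Tn (vertex y) (YY Tn _ Vy) (S a) (SP a).1.
  have [c Qc yc] := deep_component_vertex (s := k + M) (t := Tn) (lexx _)
    (QP a).1.1 (SP a).2 (components_sub (SP a).1.1) yT.
  exists (y^-1 * c)%g; last by rewrite mulVKg.
  apply: (@ball_word_ball _ R); rewrite -(cayley_act_mdist y).
  rewrite !cayley_act_vertex mulg1 mulVKg; apply: (lt_trans yc).
  by apply: archi_boundP; rewrite addr_ge0.
have [y Yy] := separating_neq0 dC1.1 dC2.1 C12.
have [v Yv _] := subgraph_near_vertex Ysub Yy.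
(* For h in [H], the vertex hv lies on hY, hence M-close to Y, and is at distance c from h. This
   gives M + c; in the other direction, 1 leads to a vertex of Y and r from there to [H]. *)
set c : R := mdist (vertex 1%g : cayley R G) (vertex v).
have c0 : 0 <= c := mdist_ge0 _ _.
apply: (@dHaus_lty _ _ _ _ (r + 1 + (M + c))).
- by rewrite !addr_ge0.
- move=> x /(subgraph_near_vertex Ysub)[u Yu xu].
  apply: (@nbdS _ _ (r + 1) _ _ _ _ (@subset_refl _ _)).
    by rewrite lerDl addr_ge0.
  by apply: nbd_trans xu _; apply: VH; exists u.
- move=> _ [h /generatedP[n /wordY[_ hY _]] <-].
  apply: (@nbdS _ _ (M + c) _ _ _ _ (@subset_refl _ _)).
    by rewrite lerDr addr_ge0.
  apply: (@nbd_trans _ _ _ _ _ _ (vertex (h * v)%g)).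
    by rewrite -{1}[h]mulg1 -!cayley_act_vertex cayley_act_mdist.
  by apply: hY; exists (vertex v) => //; rewrite cayley_act_vertex.
Qed.
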